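(* Let $K$ be an infinite field and let $n\ge 2$. Let $Q_n$ be the quiver with vertices $1,2,\dots,n$ and, for each $i\in\{1,\dots,n-1\}$, exactly two arrows between $i$ and $i+1$, both directed from the even vertex of the pair to the odd vertex of the pair (and no other arrows). Let $\alpha=(2,3,\dots,3,1)$, i.e. $\alpha(1)=2$, $\alpha(i)=3$ for $1<i<n$, and $\alpha(n)=1$. Then the semi-invariants in $\mathrm{SI}(Q_n,\alpha)$ of nonzero weights $\sigma$ with $|\sigma|_\alpha<2^n-2$ do not define the null cone for the action of $\mathrm{SL}_\alpha$ on $\mathrm{Rep}(Q_n,\alpha)$ (i.e. their common zero set is not equal to the null cone). Hence the semi-invariants of weights $\sigma$ with $|\sigma|_\alpha<2^n-2$ do not generate the ring $\mathrm{SI}(Q_n,\alpha)$.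
   Context: For a quiver $Q=(Q_0,Q_1)$ (finite directed graph; an arrow $a$ has tail $ta$ and head $ha$) and a dimension vector $\alpha\in\mathbb{Z}_{\ge0}^{Q_0}$, $\mathrm{Rep}(Q,\alpha)=\prod_{a\in Q_1}\mathrm{Mat}_{\alpha(ha),\alpha(ta)}(K)$, $\mathrm{GL}_\alpha=\prod_{x\in Q_0}\mathrm{GL}_{\alpha(x)}(K)$ and $\mathrm{SL}_\alpha=\prod_{x\in Q_0}\mathrm{SL}_{\alpha(x)}(K)$. The group $\mathrm{GL}_\alpha$ acts on $\mathrm{Rep}(Q,\alpha)$ by $(A(x))_x\cdot (V(a))_a=(A(ha)V(a)A(ta)^{-1})_a$, and on polynomial functions by $(A\cdot f)(V)=f(A^{-1}\cdot V)$. The ring of semi-invariants is $\mathrm{SI}(Q,\alpha)=K[\mathrm{Rep}(Q,\alpha)]^{\mathrm{SL}_\alpha}$. A weight is a function $\sigma:Q_0\to\mathbb{Z}$; put $\chi_\sigma(A)=\prod_x\det(A(x))^{\sigma(x)}$ and $\mathrm{SI}(Q,\alpha)_\sigma=\{f\in K[\mathrm{Rep}(Q,\alpha)] : A\cdot f=\chi_\sigma(A)f\ \forall A\in\mathrm{GL}_\alpha\}$; its elements are the semi-invariants of weight $\sigma$. One has $\mathrm{SI}(Q,\alpha)=\bigoplus_\sigma \mathrm{SI}(Q,\alpha)_\sigma$, and $\mathrm{SI}(Q,\alpha)_\sigma=0$ unless $\sigma\cdot\alpha:=\sum_x\sigma(x)\alpha(x)=0$. For $\sigma\cdot\alpha=0$,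 set $|\sigma|_\alpha=\sigma_+\cdot\alpha=\sigma_-\cdot\alpha$, where $\sigma_+(x)=\max\{\sigma(x),0\}$ and $\sigma_-(x)=\max\{-\sigma(x),0\}$. The null cone is the common zero set in $\mathrm{Rep}(Q,\alpha)$ of all non-constant homogeneous (with respect to total polynomial degree) elements of $\mathrm{SI}(Q,\alpha)$. *)

(* Defs.v *)
From mathcomp Require Import all_boot all_order all_algebra.
From mathcomp Require Export mpoly.

Set Implicit Arguments.
Unset Strict Implicit.
Unset Printing Implicit Defensive.

Import Order.TTheory GRing.Theory Num.Theory.
Local Open Scope ring_scope.

Definition infinite_type (T : eqType) : Prop :=
  forall s : seq T, exists x : T, x \notin s.

Record quiver := Quiver {
  vertex : finType;
  arrow : finType;
  tl : arrow -> vertex;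
  hd : arrow -> vertex }.

Arguments tl {q} _.
Arguments hd {q} _.

Definition dimvec (Q : quiver) := vertex Q -> nat.

Definition weight (Q : quiver) := vertex Q -> int.

Section WeightNorm.
Variables (Q : quiver) (alpha : dimvec Q).

Definition wpos (sigma : weight Q) : weight Q := fun x => Num.max (sigma x) 0.

Definition wdot (sigma : weight Q) : int :=
  \sum_(x : vertex Q) sigma x * (alpha x)%:Z.

(* Only meaningful when [wdot sigma = 0]; the positive and negative parts of
   [sigma] then give the same value. *)
Definition wnorm (sigma : weight Q) : int := wdot (wpos sigma).

End WeightNorm.

Section SemiInvariants.
Variables (K : fieldType) (Q : quiver) (alpha : dimvec Q).

Definition rep := forall a : arrow Q, 'M[K]_(alpha (hd a), alpha (tl a)).

Definition mxfam := forall x : vertex Q, 'M[K]_(alpha x).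

Definition inGL (A : mxfam) : Prop := forall x, A x \in unitmx.

Definition inSL (A : mxfam) : Prop := forall x, \det (A x) = 1.

Definition invfam (A : mxfam) : mxfam := fun x => invmx (A x).

Definition act (A : mxfam) (V : rep) : rep :=
  fun a => A (hd a) *m V a *m invmx (A (tl a)).

(* The matrix entries, i.e. the coordinates on the representation space. *)
Definition coord_index : finType :=
  {a : arrow Q & ('I_(alpha (hd a)) * 'I_(alpha (tl a)))%type}.

Definition coord (V : rep) (c : coord_index) : K :=
  V (tag c) (tagged c).1 (tagged c).2.

(* The coordinate ring: one indeterminate per matrix entry. *)
Definition polyfun := {mpoly K[#|coord_index|]}.

Definition peval (f : polyfun) (V : rep) : K :=
  f.@[fun i => coord V (enum_val i)].

Definition fact (A : mxfam) (f : polyfun) (V : rep) : K :=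
  peval f (act (invfam A) V).

Definition chi (sigma : weight Q) (A : mxfam) : K :=
  \prod_(x : vertex Q) \det (A x) ^ sigma x.

(* Identities in the coordinate ring are stated as identities of functions on
   the representation space, which is the same thing over an infinite field. *)
Definition SI (f : polyfun) : Prop :=
  forall A, inSL A -> forall V, fact A f V = peval f V.

Definition SIw (sigma : weight Q) (f : polyfun) : Prop :=
  forall A, inGL A -> forall V, fact A f V = chi sigma A * peval f V.

Definition zero_locus (S : polyfun -> Prop) (V : rep) : Prop :=
  forall f, S f -> peval f V = 0.

Definition nonconst_homog (f : polyfun) : Prop :=
  (exists d : nat, f \is d.-homog) /\ (forall c : K, f <> c%:MP).

Definition null_cone : rep -> Prop :=
  zero_locus (fun f => SI f /\ nonconst_homog f).

Definition defines_null_cone (S : polyfun -> Prop) : Prop :=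
  forall V, zero_locus S V <-> null_cone V.

(* The K-subalgebra generated by [S]. *)
Definition subalg_gen (S : polyfun -> Prop) (f : polyfun) : Prop :=
  exists (m : nat) (g : m.-tuple polyfun) (p : {mpoly K[m]}),
    (forall i : 'I_m, S (tnth g i)) /\ f = p \mPo g.

Definition generates_SI (S : polyfun -> Prop) : Prop :=
  forall f, subalg_gen S f <-> SI f.

End SemiInvariants.

Section ZigzagQuiver.
Variable n : nat.

(* Vertex [x : 'I_n] carries the label [x.+1] in {1, ..., n}. *)
Definition label (x : 'I_n) : nat := x.+1.

Lemma upper_subproof (i : 'I_n.-1) : (i.+1 < n)%N.
Proof. by rewrite -ltn_predRL. Qed.

(* The vertices labelled [i.+1] and [i.+2]. *)
Definition lower (i : 'I_n.-1) : 'I_n := widen_ord (leq_pred n) i.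
Definition upper (i : 'I_n.-1) : 'I_n := Ordinal (upper_subproof i).

(* The boolean distinguishes the two parallel arrows between [lower i] and
   [upper i]. *)
Definition Qn : quiver :=
  @Quiver 'I_n ('I_n.-1 * bool)%type
    (fun a => if odd (label (lower a.1)) then upper a.1 else lower a.1)
    (fun a => if odd (label (lower a.1)) then lower a.1 else upper a.1).

Definition alphan : dimvec Qn := fun x : 'I_n =>
  if label x == 1%N then 2%N else if label x == n then 1%N else 3%N.

End ZigzagQuiver.

(* Main.v *)
(* Let V be the direct sum, over 1 <= i < n, of the representations with a
   plane at i, a line at i + 1 and a basis of the plane (or its dual basis) as
   the two arrows. Rescaling the i-th summand fixes V, so a semi-invariant of
   weight sigma that does not vanish at V has 2 sigma(i) + sigma(i+1) = 0 for
   all i; hence sigma = c (1, -2, 4, ...), whose norm is |c| (2^n - 2).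
   On the other hand V is outside the null cone: put a copy of the space at
   vertex i above each node of depth i of a complete binary tree, and let the
   two arrows at i act along the left and right edges leaving such a node. The
   resulting matrix M, made symmetric as M + M^T so that it is square without
   dimension count, changes by a congruence under GL, and at V it is a
   permutation matrix; so its determinant F is a homogeneous semi-invariant of
   degree d > 0 with F(V) <> 0. Finally F(cV) = c^d F(V), whereas generators
   of small weight take the same value at V and cV, so they do not
   generate F. *)
Require Import Defs.
From mathcomp Require Import all_boot all_order all_algebra.
From mathcomp Require Import perm zify.
Import Order.TTheory GRing.Theory Num.Theory.
Local Open Scope ring_scope.

Set Implicit Arguments.
Unset Strict Implicit.
Unset Printing Implicit Defensive.

(** * Powers in infinite fields; determinants *)

(** For [n > 0], any [n.+1] distinct nonzero elements would be too many roots of ['X^n - 1]. *)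
Lemma infinite_nonzero_expr1 (K : fieldType) (n : nat) :
  infinite_type K -> (forall t : K, t != 0 -> t ^+ n = 1) -> n = 0%N.
Proof.
move=> Kinf tn1; apply/eqP; rewrite -leqn0 leqNgt; apply/negP => n_gt0.
have p_neq0 : 'X^n - 1 != 0 :> {poly K} by rewrite -size_poly_gt0 size_XnsubC.
suff long_roots m : exists s : seq K, [/\ uniq s, size s = m & 0 \notin s].
  have [s [us sz s0]] := long_roots n.+1.
  have rs : all (root ('X^n - 1 : {poly K})) s.
    apply/allP => t ts; rewrite rootE !hornerE ?hornerXn tn1 ?subrr //.
    by apply: contraNneq s0 => <-.
  by have := max_poly_roots p_neq0 rs us; rewrite size_XnsubC // sz ltnn.
elim: m => [|m [s [us sz s0]]]; first by exists [::].
have [x] := Kinf (0 :: s); rewrite inE negb_or => /andP[x0 xs].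
by exists (x :: s); rewrite /= xs us sz inE negb_or eq_sym x0.
Qed.

Lemma infinite_nonzero_exprz1 (K : fieldType) (z : int) :
  infinite_type K -> (forall t : K, t != 0 -> t ^ z = 1) -> z = 0.
Proof.
move=> Kinf tz1; apply/eqP; rewrite -absz_eq0; apply/eqP.
apply: (infinite_nonzero_expr1 Kinf) => t t0.
case: z tz1 => m tm1; first by rewrite -(tm1 t t0).
by apply: invr_inj; rewrite invr1 -(tm1 t t0).
Qed.

Lemma det_castmx (R : comNzRingType) (m n : nat) (e : m = n) (A : 'M[R]_m) :
  \det (castmx (e, e) A) = \det A.
Proof. by case: n / e; rewrite castmx_id. Qed.

Lemma det_mxdiag (R : comNzRingType) (m : nat) (p : 'I_m -> nat)
    (B : forall i, 'M[R]_(p i)) :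
  \det (\mxdiag_i B i) = \prod_i \det (B i).
Proof.
elim: m => [|m IHm] in p B *.
  rewrite [RHS]big_ord0; move: (mxdiag _); rewrite big_ord0 => A.
  by rewrite det_mx00.
by rewrite mxdiag_recl det_castmx det_ublock IHm big_ord_recl.
Qed.

Lemma det_dhomog (R : comNzRingType) (k n : nat)
    (A : 'M[{mpoly R[k]}]_n) :
  (forall i j, A i j \is 1.-homog) -> \det A \is n.-homog.
Proof.
move=> homA; apply: rpred_sum => s _.
suff: \prod_i A i (s i) \is n.-homog.
  by case: (s : bool) => ?; rewrite ?mul1r // mulN1r rpredN.
have homP r : \prod_(i <- r) A i (s i) \is (size r).-homog.
  elim: r => [|i r IHr] /=; first by rewrite big_nil dhomog1.
  by rewrite big_cons -add1n; apply: dhomogM.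
by have := homP (enum 'I_n); rewrite size_enum_ord big_enum.
Qed.

(** * Determinantal semi-invariants from graphs lying over a quiver *)

Section CoveringMatrix.
Variables (Q : quiver) (alpha : dimvec Q).
Variables (m : nat) (nu : 'I_m -> vertex Q) (g : arrow Q -> rel 'I_m).

(** Total in [x] and [y], with value 0 away from the ends of [a], so that blocks of different arrows
    can be added. *)
Definition arrow_block (R : comNzRingType)
    (V : forall a : arrow Q, 'M[R]_(alpha (hd a), alpha (tl a)))
    (a : arrow Q) (x y : vertex Q) : 'M[R]_(alpha x, alpha y) :=
  match hd a =P x, tl a =P y with
  | ReflectT ex, ReflectT ey => castmx (congr1 alpha ex, congr1 alpha ey) (V a)
  | _, _ => 0
  end.

(** Node [u] lies above the vertex [nu u], and [g a] is the set of edges above [a], with the head as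
    row. The ring is arbitrary so that both generic matrices and points can be plugged in. *)
Definition covering_mx (R : comNzRingType)
    (V : forall a : arrow Q, 'M[R]_(alpha (hd a), alpha (tl a))) :=
  \mxblock_(u < m, v < m) \sum_(a | g a u v) arrow_block V a (nu u) (nu v).

Definition sym_covering_mx (R : comNzRingType)
    (V : forall a : arrow Q, 'M[R]_(alpha (hd a), alpha (tl a))) :=
  covering_mx V + (covering_mx V)^T.

Lemma arrow_blockE (R : comNzRingType)
    (V : forall a : arrow Q, 'M[R]_(alpha (hd a), alpha (tl a)))
    (a : arrow Q) (phi : nat -> nat -> R) x y i j :
  (forall i j, V a i j = phi i j) ->
  arrow_block V a x y i j = if (hd a == x) && (tl a == y) then phi i j else 0.
Proof.
move=> Vphi; rewrite /arrow_block.
case: eqP => [ex|]; last by rewrite mxE.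
case: eqP => [ey|]; last by rewrite mxE.
by rewrite castmxE Vphi.
Qed.

Lemma map_covering_mx (R S : comNzRingType) (f : {rmorphism R -> S})
    (V : forall a : arrow Q, 'M[R]_(alpha (hd a), alpha (tl a))) :
  map_mx f (covering_mx V) = covering_mx (fun a => map_mx f (V a)).
Proof.
apply/matrixP => s t; rewrite !mxE !summxE rmorph_sum; apply: eq_bigr => a _.
rewrite /arrow_block; case: eqP => [ex|]; last by rewrite !mxE rmorph0.
case: eqP => [ey|]; last by rewrite !mxE rmorph0.
by rewrite !castmxE mxE.
Qed.

Lemma eq_covering_mx (R : comNzRingType)
    (V W : forall a : arrow Q, 'M[R]_(alpha (hd a), alpha (tl a))) :
  (forall a, V a = W a) -> covering_mx V = covering_mx W.
Proof.
move=> VW; apply: eq_mxblock => u v; apply: eq_bigr => a _.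
by rewrite /arrow_block; case: eqP => // ex; case: eqP => // ey; rewrite VW.
Qed.

Lemma covering_mxZ (R : comNzRingType) (c : R)
    (V : forall a : arrow Q, 'M[R]_(alpha (hd a), alpha (tl a))) :
  covering_mx (fun a => c *: V a) = c *: covering_mx V.
Proof.
apply/matrixP => s t; rewrite !mxE !summxE mulr_sumr; apply: eq_bigr => a _.
rewrite /arrow_block; case: eqP => [ex|]; last by rewrite !mxE mulr0.
case: eqP => [ey|]; last by rewrite !mxE mulr0.
by rewrite !castmxE mxE.
Qed.

Variable K : fieldType.

Definition generic_rep (a : arrow Q) :
    'M[polyfun K alpha]_(alpha (hd a), alpha (tl a)) :=
  \matrix_(i, j) 'X_(enum_rank (Tagged (fun a : arrow Q =>
    ('I_(alpha (hd a)) * 'I_(alpha (tl a)))%type) (i, j))).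

Definition covering_det : polyfun K alpha :=
  \det (sym_covering_mx generic_rep).

(** Evaluation is a ring morphism taking the generic matrices to [V], so it commutes with the
    determinant. *)
Lemma peval_covering_det V :
  peval covering_det V = \det (sym_covering_mx (V : rep K alpha)).
Proof.
rewrite /peval -det_map_mx map_mxD -matrix.map_trmx map_covering_mx.
rewrite (@eq_covering_mx K _ V) // => a.
apply/matrixP => i j; rewrite !mxE.
by rewrite /= mevalXU enum_rankK.
Qed.

Lemma dhomog_covering_det :
  covering_det \is (\sum_u alpha (nu u))%N.-homog.
Proof.
have hom s t : covering_mx generic_rep s t \is 1.-homog.
  rewrite mxE summxE; apply: rpred_sum => a _; rewrite /arrow_block.
  case: eqP => [ex|]; last by rewrite mxE dhomog0.
  case: eqP => [ey|]; last by rewrite mxE dhomog0.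
  by rewrite castmxE mxE dhomogX /= mdeg1.
by apply: det_dhomog => s t; rewrite mxE [X in _ + X]mxE rpredD.
Qed.

Lemma peval_covering_detZ c (V : rep K alpha) :
  peval covering_det (fun a => c *: V a) =
    c ^+ (\sum_u alpha (nu u)) * peval covering_det V.
Proof.
rewrite !peval_covering_det /sym_covering_mx covering_mxZ.
by rewrite linearZ -scalerDr detZ.
Qed.

Variable sink : pred (vertex Q).
Hypothesis sink_hd : forall a, sink (hd a).
Hypothesis source_tl : forall a, ~~ sink (tl a).

(* Sources are acted on contragrediently so that one and the same block
   diagonal matrix acts on both sides of [covering_mx] as a congruence. *)
Definition congruence_fam (A : mxfam K alpha) x : 'M[K]_(alpha x) :=
  if sink x then A x else (invmx (A x))^T.

Lemma arrow_block_act (A : mxfam K alpha) (V : rep K alpha) a x y :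
  arrow_block (act A V) a x y =
    congruence_fam A x *m arrow_block V a x y *m (congruence_fam A y)^T.
Proof.
rewrite /arrow_block; case: eqP => [ex|]; last by rewrite mulmx0 mul0mx.
case: eqP => [ey|]; last by rewrite mulmx0 mul0mx.
case: x / ex; case: y / ey; rewrite !castmx_id /congruence_fam.
by rewrite sink_hd (negbTE (source_tl a)) trmxK.
Qed.

Lemma covering_mx_act (A : mxfam K alpha) (V : rep K alpha) :
  let D := \mxdiag_(u < m) congruence_fam A (nu u) in
  covering_mx (act A V) = D *m covering_mx V *m D^T.
Proof.
rewrite /= tr_mxdiag mul_mxdiag_mxblock mul_mxblock_mxdiag.
apply: eq_mxblock => u v; rewrite mulmx_sumr mulmx_suml; apply: eq_bigr => a _.
exact: arrow_block_act.
Qed.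

(** [covering_mx] and its transpose undergo the same congruence by [D], hence so does their sum, and
    [\det D = 1] on the special linear group. *)
Lemma SI_covering_det : SI covering_det.
Proof.
move=> A SLA V; rewrite /fact !peval_covering_det /sym_covering_mx.
rewrite covering_mx_act; set D := mxdiag _.
have detD : \det D = 1.
  rewrite det_mxdiag big1 // => u _; rewrite /congruence_fam /invfam.
  by case: ifP => _; rewrite ?det_tr !det_inv SLA ?invr1.
rewrite !trmx_mul trmxK mulmxA -mulmxDl -mulmxDr !det_mulmx det_tr detD.
by rewrite mul1r mulr1.
Qed.

End CoveringMatrix.

(** * The binary tree, and nonvanishing at the split representation *)

Section Zigzag.
Variable n : nat.
Local Notation alpha := (@alphan n).

Definition child (b : bool) (u : nat) : nat := (u.*2.+1 + b)%N.

Lemma depth_subproof (u : 'I_(2 ^ n).-1) : (trunc_log 2 u.+1 < n)%N.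
Proof.
rewrite -(@ltn_exp2l 2) //; apply: leq_ltn_trans (trunc_logP _ _) _ => //.
by have := ltn_ord u; rewrite -ltnS prednK // expn_gt0.
Qed.

(* ['I_(2 ^ n).-1] is the complete binary tree with [n] levels, its nodes being
   numbered level by level from 0. *)
Definition depth (u : 'I_(2 ^ n).-1) : vertex (Qn n) :=
  Ordinal (depth_subproof u).

Lemma depth_child b (u v : 'I_(2 ^ n).-1) :
  v = child b u :> nat -> depth v = (depth u).+1 :> nat.
Proof.
move=> vE; rewrite /depth /= vE trunc_log2S; last by rewrite /child; lia.
by congr (trunc_log 2 _).+1; rewrite /child; case: b {vE}; lia.
Qed.

(** The parent indexes the row exactly when the lower vertex is the head. Depths need no test here:
    [arrow_block] vanishes at wrong vertices. *)
Definition tree_edge (a : arrow (Qn n)) : rel 'I_(2 ^ n).-1 := fun u v =>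
  if odd (label (lower a.1)) then v == child a.2 u :> nat
  else u == child a.2 v :> nat.

Definition split_entry (a : arrow (Qn n)) (k l : nat) : bool :=
  if odd (label (lower a.1)) then (k == a.2) && (l == (alpha (upper a.1)).-1)
  else (l == a.2) && (k == (alpha (upper a.1)).-1).

(* At each vertex the plane occupies the first two coordinates and the line
   the last one; at the first and last vertices only one of them is present. *)
Definition split_rep (K : fieldType) : rep K alpha :=
  fun a => \matrix_(i, j) (split_entry a i j)%:R.

Definition sink (x : vertex (Qn n)) : bool := odd (label x).

Lemma sink_hd (a : arrow (Qn n)) : sink (hd a).
Proof.
by case: a => i b; rewrite /sink /=; case: ifP => // /negbT; rewrite /label /=.
Qed.

Lemma source_tl (a : arrow (Qn n)) : ~~ sink (tl a).
Proof.
case: a => i b; rewrite /sink /=; case: ifP; last by move=> ->.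
by rewrite /label /= negbK.
Qed.

(** Joins the plane coordinate [a.2] of a parent [u] to the line coordinate of its child [v],
    whatever the direction of [a]. *)
Definition match_edge (a : arrow (Qn n)) (u v : 'I_(2 ^ n).-1) (k l : nat) :=
  [&& depth u == lower a.1, v == child a.2 u :> nat,
      k == a.2 & l == (alpha (depth v)).-1].

Import tagnat.

Lemma covering_mx_split (K : fieldType) s t :
  covering_mx depth tree_edge (@split_rep K) s t =
  \sum_a (if odd (label (lower a.1))
          then match_edge a (sig1 s) (sig1 t) (sig2 s) (sig2 t)
          else match_edge a (sig1 t) (sig1 s) (sig2 t) (sig2 s))%:R.
Proof.
rewrite mxE summxE big_mkcond; apply: eq_bigr => a _.
rewrite (@arrow_blockE _ _ _ _ _ (fun k l => (split_entry a k l)%:R));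
  last by move=> i j; rewrite mxE.
case: a => i b; rewrite /tree_edge /split_entry /match_edge /=.
move: (nat_of_ord (sig2 s)) (nat_of_ord (sig2 t)) => k l.
(* A child lies one level deeper, so the condition at the upper end of the arrow follows from the
   one at the lower end. *)
have upE (u v : 'I_(2 ^ n).-1) :
    v = child b u :> nat -> depth u = lower i -> depth v = upper i.
  by move=> /depth_child vE uE; apply: val_inj; rewrite [LHS]vE uE.
case: (odd i) => /=; last first.
- case: eqP => [vE|_]; last by rewrite andbF.
  rewrite eq_sym; case: eqP => //= uE.
  by rewrite (upE _ _ vE uE) eqxx.
- case: eqP => [vE|_]; last by rewrite andbF.
  rewrite andbC eq_sym; case: eqP => //= uE.
  by rewrite (upE _ _ vE uE) eqxx.
Qed.

Lemma sym_covering_mx_split (K : fieldType) s t :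
  sym_covering_mx depth tree_edge (@split_rep K) s t =
  \sum_a ((match_edge a (sig1 s) (sig1 t) (sig2 s) (sig2 t))%:R
        + (match_edge a (sig1 t) (sig1 s) (sig2 t) (sig2 s))%:R).
Proof.
rewrite mxE [X in _ + X]mxE !covering_mx_split -big_split.
by apply: eq_bigr => a _ /=; case: ifP => // _; rewrite addrC.
Qed.

Hypothesis n_ge2 : (2 <= n)%N.

Lemma alphan_inner (x : 'I_n) : x != 0%N :> nat -> x.+1 != n -> alpha x = 3%N.
Proof.
by rewrite /alphan /label => x0 xn; rewrite eqSS (negbTE x0) (negbTE xn).
Qed.

Lemma depth_eq0 (u : 'I_(2 ^ n).-1) : u != 0%N :> nat -> depth u != 0%N :> nat.
Proof. by move=> u0; rewrite /depth /= trunc_log_eq0 /= ltnS leqn0. Qed.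

Lemma alphan_root (u : 'I_(2 ^ n).-1) :
  u = 0%N :> nat -> alpha (depth u) = 2%N.
Proof. by rewrite /alphan /label /= => ->. Qed.

Lemma alphan_parent b (u v : 'I_(2 ^ n).-1) :
  v = child b u :> nat -> u != 0%N :> nat -> alpha (depth u) = 3%N.
Proof.
move=> /depth_child vE u0; rewrite alphan_inner ?depth_eq0 //.
by rewrite -vE neq_ltn ltn_ord.
Qed.

(** A parent other than the root has dimension 3, so its last coordinate 2 is not a plane
    coordinate: lines are not joined downwards. *)
Lemma match_edge_last (a : arrow (Qn n)) (u w : 'I_(2 ^ n).-1) k :
  u != 0%N :> nat -> ~~ match_edge a u w (alpha (depth u)).-1 k.
Proof.
move=> u0; apply/negP => /and4P[_ /eqP wE]; rewrite (alphan_parent wE u0).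
by case: a.2.
Qed.

(** Dually, the plane coordinates of a node with a child are not joined upwards. *)
Lemma match_edge_plane (a : arrow (Qn n)) (u v w : 'I_(2 ^ n).-1) (b : bool) k :
  v = child b u :> nat -> ~~ match_edge a w u k b.
Proof.
move=> vE; apply/negP => /and4P[_ /eqP uE _]; rewrite (alphan_parent vE) ?uE //.
by case: b {vE}.
Qed.

Lemma eq_rank_sig (m : nat) (p : 'I_m -> nat) (s t : 'I_(\sum_i p i)) :
  (s == t) = (sig1 s == sig1 t) && (sig2 s == sig2 t :> nat).
Proof. by rewrite -eq_Rank !sig2K. Qed.

Lemma sig2_Rank (m : nat) (p : 'I_m -> nat) i (k : 'I_(p i)) :
  sig2 (Rank i k) = k :> nat.
Proof. by rewrite Rank2K. Qed.

Lemma child_bound b (u : 'I_(2 ^ n).-1) :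
  (depth u).+1 != n -> (child b u < (2 ^ n).-1)%N.
Proof.
move=> un; have {}un : ((depth u).+2 <= n)%N by rewrite ltn_neqAle un ltn_ord.
have := trunc_log_ltn u.+1 (isT : 1 < 2)%N.
have : (2 ^ (trunc_log 2 u.+1).+2 <= 2 ^ n)%N by rewrite leq_exp2l.
by rewrite !expnS /child; case: b; lia.
Qed.

Lemma child_inj b b' u u' : child b u = child b' u' -> b = b' /\ u = u'.
Proof. by rewrite /child; case: b; case: b'; lia. Qed.

Lemma sum_indicator (K : fieldType) (I : finType) (a0 : I) (f g : I -> bool) c :
  (forall a, f a = (a == a0) && c) -> (forall a, ~~ g a) ->
  \sum_a ((f a)%:R + (g a)%:R) = c%:R :> K.
Proof.
move=> fE gE; rewrite (bigD1 a0) //= big1 => [|a /negbTE aa0].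
  by rewrite fE eqxx (negbTE (gE _)) !addr0.
by rewrite fE aa0 (negbTE (gE _)) addr0.
Qed.

Lemma match_edge_child (a : arrow (Qn n)) (i : 'I_n.-1) (b : bool)
    (u v w : 'I_(2 ^ n).-1) k :
  depth u = lower i -> v = child b u :> nat ->
  match_edge a u w b k = [&& a == (i, b), v == w & (alpha (depth v)).-1 == k].
Proof.
case: a => j c; rewrite /match_edge /= xpair_eqE => uE vE.
have -> : (depth u == lower j) = (j == i).
  by rewrite uE -!val_eqE /= eq_sym.
case: eqVneq => //= _; rewrite -(inj_eq val_inj) /= vE.
have [->|bc] := eqVneq c b; last first.
  by case: c b bc {vE} => [] [] //= _; rewrite !andbF.
rewrite eqxx /= [_ == child _ _]eq_sym; case: eqP => //= wE.
by rewrite eq_sym (_ : w = v) //; apply: val_inj; rewrite /= vE.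
Qed.

Lemma match_child_edge (a : arrow (Qn n)) (i : 'I_n.-1) (b : bool)
    (u v w : 'I_(2 ^ n).-1) k :
  depth u = lower i -> v = child b u :> nat ->
  match_edge a w v k (alpha (depth v)).-1 =
    [&& a == (i, b), u == w & b == k :> nat].
Proof.
case: a => j c; rewrite /match_edge /= xpair_eqE eqxx andbT => uE vE.
apply/and3P/and3P => [[/eqP wE /eqP vE' /eqP ->]|].
  have [bc uw] : b = c /\ u = w :> nat by apply: child_inj; rewrite -vE.
  have {}uw : u = w by apply: val_inj.
  rewrite bc uw !eqxx andbT; split=> //; rewrite -val_eqE /=.
  by have /(congr1 val) /= <- : lower j = lower i by rewrite -wE -uw.
move=> [/andP[/eqP -> /eqP ->] /eqP <- /eqP <-].
by rewrite uE vE !eqxx.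
Qed.

(** The edges form a perfect matching of the coordinates: a line coordinate is matched with the
    parent, a plane coordinate with one child. *)
Lemma sym_covering_mx_partner (K : fieldType) t : exists t', forall s,
  sym_covering_mx depth tree_edge (@split_rep K) t' s = (t == s)%:R.
Proof.
pose v := sig1 t; pose l : nat := sig2 t.
have l_lt : (l < alpha (depth v))%N by apply: ltn_ord.
suff [u [k uk]] : exists u (k : 'I_(alpha (depth u))), forall w (m : nat),
    \sum_a ((match_edge a u w k m)%:R + (match_edge a w u m k)%:R)
      = [&& v == w & l == m]%:R :> K.
  exists (Rank u k) => s; rewrite sym_covering_mx_split eq_rank_sig -uk.
  by under eq_bigr do rewrite sig2_Rank Rank1K.
have lowerE (u v' : 'I_(2 ^ n).-1) b :
    v' = child b u :> nat -> exists i, depth u = lower i.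
  move=> /depth_child v'E; have ult : (depth u < n.-1)%N.
    by rewrite -ltnS prednK -?v'E ?ltn_ord // (ltn_trans _ n_ge2).
  by exists (Ordinal ult); apply: val_inj.
have [/andP[v0 /eqP lE]|] :=
  boolP ((v != 0%N :> nat) && (l == (alpha (depth v)).-1)).
  (* A line coordinate: the children of [u] are [2u+1] and [2u+2], so the parity of [v] tells which
     child it is. *)
  pose b := ~~ odd v.
  have uP : (v.-1./2 < (2 ^ n).-1)%N.
    by apply: leq_ltn_trans (ltn_ord v); lia.
  pose u : 'I_(2 ^ n).-1 := Ordinal uP.
  have vE : v = child b u :> nat by rewrite /child /u /b /=; lia.
  have [i uE] := lowerE _ _ _ vE.
  have bP : (b < alpha (depth u))%N.
    have [u0|u0] := eqVneq (u : nat) 0%N.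
      by rewrite alphan_root //; case: (b).
    by rewrite (alphan_parent vE u0); case: (b).
  exists u, (Ordinal bP) => w m /=; apply: (@sum_indicator _ _ (i, b)) => a.
    by rewrite (match_edge_child _ _ _ uE vE) lE.
  exact: match_edge_plane vE.
rewrite negb_and negbK => t_plane.
(* Otherwise [t] is a plane coordinate, and [v] is not a leaf since a leaf carries only its line. *)
have [l_lt2 v_inner] : (l < 2)%N /\ (depth v).+1 != n.
  have [v0|v0] := eqVneq (v : nat) 0%N.
    by rewrite alphan_root // in l_lt; rewrite l_lt /= v0 neq_ltn n_ge2.
  rewrite (negbTE v0) /= in t_plane.
  have [vn|vn] := eqVneq (depth v).+1 n; last first.
    by rewrite alphan_inner ?depth_eq0 // in l_lt t_plane; lia.
  have a1 : alpha (depth v) = 1%N.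
    rewrite /alphan /label vn eqxx; case: eqP => // n1.
    by have := n_ge2; rewrite n1.
  by rewrite a1 in l_lt t_plane; lia.
pose b := l == 1%N.
have lb : b = l :> nat by rewrite /b; case: (l) l_lt2 => [|[]].
pose c : 'I_(2 ^ n).-1 := Ordinal (child_bound b v_inner).
have cE : c = child b v :> nat by [].
have [i vE] := lowerE _ _ _ cE.
have lastP : ((alpha (depth c)).-1 < alpha (depth c))%N.
  by rewrite prednK // /alphan; case: ifP => //; case: ifP.
exists c, (Ordinal lastP) => w m /=.
under eq_bigr do rewrite addrC.
apply: (@sum_indicator _ _ (i, b)) => a.
  by rewrite (match_child_edge _ _ _ vE cE) lb.
by rewrite match_edge_last // cE.
Qed.

Lemma sym_covering_mx_split_unit (K : fieldType) :
  sym_covering_mx depth tree_edge (@split_rep K) \in unitmx.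
Proof.
rewrite -row_full_unit -sub1mx; apply/row_subP => t.
have [t' t'E] := sym_covering_mx_partner K t.
suff -> : row t 1%:M = row t' (sym_covering_mx depth tree_edge (@split_rep K)).
  exact: row_sub.
by apply/rowP => s; rewrite mxE [LHS]mxE [RHS]mxE t'E.
Qed.

End Zigzag.

(** * Scaling a representation *)

Lemma eq_peval (K : fieldType) (Q : quiver) (alpha : dimvec Q)
    (f : polyfun K alpha) (V W : rep K alpha) :
  (forall a, V a = W a) -> peval f V = peval f W.
Proof. by move=> VW; apply: meval_eq => i; rewrite /Defs.coord VW. Qed.

(** Arrows go from sources to sinks, so scaling by [c] is the action of scalar matrices, equal to
    [c] at sinks and 1 at sources. *)
Lemma SIw_scale (K : fieldType) (Q : quiver) (alpha : dimvec Q)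
    (sink : pred (vertex Q)) (sigma : weight Q) (f : polyfun K alpha)
    (V : rep K alpha) (c : K) :
  (forall a, sink (hd a)) -> (forall a, ~~ sink (tl a)) ->
  SIw sigma f -> c != 0 -> exists e,
  peval f (fun a => c *: V a) = e * peval f V
    /\ ((forall x, sigma x = 0) -> e = 1).
Proof.
move=> sink_hd source_tl fsigma c0.
pose A : mxfam K alpha := fun x => (if sink x then c^-1 else 1)%:M.
have GLA : inGL A.
  move=> x; rewrite /A unitmxE det_scalar unitrX // unitfE.
  by case: ifP => _; rewrite ?oner_eq0 ?invr_eq0.
exists (chi sigma A); split; last first.
  by move=> sigma0; rewrite /chi big1 // => x _; rewrite sigma0.
rewrite -fsigma // /fact; apply: eq_peval => a.
rewrite /act /invfam invmxK /A sink_hd (negbTE (source_tl a)).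
by rewrite invmx_scalar invrK mul_scalar_mx mulmx1.
Qed.

(** * Weights of semi-invariants that do not vanish at the split representation *)

Section SmallWeights.
Variable n : nat.
Hypothesis n_ge2 : (2 <= n)%N.
Local Notation alpha := (@alphan n).

(* The index i of the summand of [split_rep] containing the k-th basis vector
   at vertex x. *)
Definition summand (x : 'I_n) (k : nat) : nat :=
  if (k < 2)%N && (x.+1 != n) then x : nat else x.-1.

Lemma lower_inner (i : 'I_n.-1) : (lower i).+1 != n.
Proof. by have := ltn_ord i; rewrite /=; lia. Qed.

Lemma summand_plane (i : 'I_n.-1) (b : bool) : summand (lower i) b = i.
Proof. by rewrite /summand lower_inner; case: b. Qed.

Lemma summand_line (i : 'I_n.-1) :
  summand (upper i) (alpha (upper i)).-1 = i.
Proof.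
rewrite /summand; case: eqVneq => [|un]; first by rewrite andbF.
by rewrite alphan_inner.
Qed.

(** The right-hand side is the dimension vector of the [i]-th summand. *)
Lemma card_summand (x : 'I_n) (i : 'I_n.-1) :
  #|[pred k : 'I_(alpha x) | summand x k == i]|
    = ((x == lower i) * 2 + (x == upper i))%N.
Proof.
rewrite -sum1_card big_mkcond /= -!(inj_eq val_inj) /=.
rewrite -(big_mkord xpredT (fun k => if summand x k == i then 1 else 0)%N).
have [x0|x0] := eqVneq (x : nat) 0%N.
  have -> : alpha x = 2%N by rewrite /alphan /label x0.
  rewrite unlock /= /summand x0 /=; have -> : (1 != n)%N by lia.
  by case: eqP.
have [xn|xn] := eqVneq x.+1 n.
  have -> : alpha x = 1%N.
    by rewrite /alphan /label xn eqxx; case: eqP n_ge2 => // ->.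
  rewrite unlock /= /summand xn eqxx andbF addn0.
  by have := ltn_ord i; case: eqP; case: eqP; case: eqP; lia.
rewrite alphan_inner // unlock /= /summand xn /=.
by case: eqP; case: eqP; case: eqP; lia.
Qed.

Variable K : fieldType.

Definition summand_torus (i : 'I_n.-1) (t : K) : mxfam K alpha :=
  fun x => diag_mx (\row_k (if summand x k == i then t else 1)).

Lemma det_summand_torus i t x :
  \det (summand_torus i t x) = t ^+ ((x == lower i) * 2 + (x == upper i)).
Proof.
rewrite det_diag; under eq_bigr do rewrite mxE.
by rewrite -big_mkcond prodr_const card_summand.
Qed.

Lemma inGL_summand_torus i t : t != 0 -> inGL (summand_torus i t).
Proof. by move=> t0 x; rewrite unitmxE det_summand_torus unitrX // unitfE. Qed.

Lemma chi_summand_torus sigma i t : t != 0 ->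
  chi sigma (summand_torus i t) = t ^ (sigma (lower i) * 2 + sigma (upper i)).
Proof.
move=> t0; have ul : upper i != lower i by rewrite -(inj_eq val_inj) /=; lia.
rewrite /chi (bigD1 (lower i)) //= (bigD1 (upper i)) //=.
rewrite big1 ?mulr1 => [|x /andP[/negbTE xl /negbTE xu]]; last first.
  by rewrite det_summand_torus xl xu exp1rz.
rewrite !det_summand_torus !eqxx (negbTE ul) eq_sym (negbTE ul).
rewrite !exprnP !exprz_exp expfzDr // mulrC [X in _ = X]mulrC.
by rewrite mul1r [_ * 2]mulrC.
Qed.

(** Each nonzero entry of [split_rep] links two basis vectors of the same summand. *)
Lemma act_summand_torus i t a : t != 0 ->
  act (invfam (summand_torus i t)) (@split_rep n K) a = split_rep K a.
Proof.
move=> t0; have GLA := inGL_summand_torus i t0.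
rewrite /act /invfam invmxK -mulmxA.
suff -> : split_rep K a *m summand_torus i t (tl a) =
          summand_torus i t (hd a) *m split_rep K a by rewrite mulKmx.
rewrite mul_mx_diag mul_diag_mx; apply/matrixP => k l; rewrite !mxE.
case Ekl: (split_entry a k l); last by rewrite mulr0 mul0r.
rewrite mul1r mulr1; suff -> : summand (tl a) l = summand (hd a) k by [].
move: (nat_of_ord k) (nat_of_ord l) Ekl => {}k {}l.
case: a => j b; rewrite /split_entry /=; case: (odd j) => /=.
  by move=> /andP[/eqP -> /eqP ->]; rewrite summand_line summand_plane.
by move=> /andP[/eqP -> /eqP ->]; rewrite summand_line summand_plane.
Qed.

Hypothesis Kinf : infinite_type K.

Lemma SIw_split_rec sigma (f : polyfun K alpha) (i : 'I_n.-1) :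
  SIw sigma f -> peval f (@split_rep n K) != 0 ->
  sigma (upper i) = sigma (lower i) * - 2.
Proof.
move=> fsigma fV; suff: sigma (lower i) * 2 + sigma (upper i) = 0 by lia.
apply: (infinite_nonzero_exprz1 Kinf) => t t0.
apply: (mulIf fV); rewrite mul1r -chi_summand_torus // -fsigma.
  by apply: eq_peval => a; apply: act_summand_torus.
exact: inGL_summand_torus.
Qed.

Lemma SIw_split_geometric sigma (f : polyfun K alpha) (x0 x : 'I_n) :
  SIw sigma f -> peval f (@split_rep n K) != 0 -> x0 = 0%N :> nat ->
  sigma x = sigma x0 * (- 2) ^+ x.
Proof.
move=> fsigma fV x00; case: x => k; elim: k => [|k IHk] kn.
  by rewrite mulr1; congr (sigma _); apply: val_inj.
have kn' : (k < n.-1)%N by rewrite -ltnS prednK // ltnW.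
have := SIw_split_rec (Ordinal kn') fsigma fV.
have -> : upper (Ordinal kn') = Ordinal kn by apply: val_inj.
move=> ->; rewrite exprSr mulrA -(IHk (ltnW kn)); congr (sigma _ * _).
exact: val_inj.
Qed.

(** The sum is twice the norm [2 ^ n - 2] of the weight 1, -2, 4, ...; the 4 is moved across to
    avoid truncated subtraction. *)
Lemma sum_exp2_alphan : (\sum_(x < n) 2 ^ x * alpha x + 4 = 2 ^ n.+1)%N.
Proof.
pose F k := (2 ^ k * if k == 0 then 2 else if k.+1 == n then 1 else 3)%N.
rewrite (eq_bigr (fun x : 'I_n => F x)); last by [].
rewrite -(big_mkord xpredT F) /F; case: n n_ge2 => [|[|m]] // _.
rewrite big_nat_recr //= eqxx.
suff geo k : (k <= m)%N ->
    (\sum_(0 <= i < k.+1)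
      2 ^ i * (if i == 0 then 2 else if i.+1 == m.+2 then 1 else 3) + 4
      = 3 * 2 ^ k.+1)%N.
  by rewrite addnAC geo // !expnS; lia.
elim: k => [|k IHk] km; first by rewrite big_nat1.
rewrite big_nat_recr //= addnAC IHk ?(ltnW km) // eqSS ltn_eqF //.
by rewrite !expnS; lia.
Qed.

(** Twice the positive part of [s] is [|s| + s], and the terms [s] contribute 0 in total. *)
Lemma wnorm_double (sigma : weight (Qn n)) : wdot alpha sigma = 0 ->
  wnorm alpha sigma * 2 = \sum_(x < n) `|sigma x| * (alpha x)%:Z.
Proof.
move=> sigma0; rewrite -[RHS]addr0 -{2}sigma0 /wnorm /wdot mulr_suml -big_split.
by apply: eq_bigr => x _; rewrite /wpos /=; lia.
Qed.

Lemma SIw_small_weight sigma (f : polyfun K alpha) :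
  SIw sigma f -> wdot alpha sigma = 0 -> wnorm alpha sigma < 2 ^+ n - 2 ->
  peval f (@split_rep n K) != 0 -> forall x, sigma x = 0.
Proof.
move=> fsigma sigma0 small fV x; have n_gt0 : (0 < n)%N by apply: ltnW.
pose x0 : 'I_n := Ordinal n_gt0.
have geo y := SIw_split_geometric y fsigma fV (erefl : x0 = 0%N :> nat).
have [s0|s0] := eqVneq (sigma x0) 0; first by rewrite geo s0 mul0r.
have := wnorm_double sigma0.
under eq_bigr do rewrite geo normrM normrX normrN -mulrA.
rewrite -mulr_sumr.
have -> : \sum_(y < n) `|2 : int| ^+ y * (alpha y)%:Z = 2 ^+ n * 2 - 4.
  have /(congr1 Posz) := sum_exp2_alphan; rewrite expnSr PoszD PoszM.
  have -> m : (2 ^ m)%N%:Z = 2 ^+ m by rewrite -natrX natz.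
  move=> <-; rewrite addrK -natz natr_sum; apply: eq_bigr => y _.
  by rewrite natrM natrX !natz.
(* With [N = 2 ^+ n], the norm is [N - 2 >= 0] times the absolute value of the nonzero integer
   [sigma x0], so it is at least [N - 2]. *)
move: small; have : 2 <= 2 ^+ n :> int.
  by rewrite -{1}[2]expr1; apply: ler_weXn2l => //; apply: ltnW.
move: (2 ^+ n) => N; nia.
Qed.

End SmallWeights.

Theorem proposition1p5 (K : fieldType) (n : nat)
  (Kinf : infinite_type K) (n_ge2 : (2 <= n)%N) :
  ~ @defines_null_cone K (Qn n) (@alphan n)
      (fun f => exists sigma : weight (Qn n),
         [/\ exists x, sigma x <> 0,
             wdot (@alphan n) sigma = 0,
             wnorm (@alphan n) sigma < 2 ^+ n - 2
           & SIw sigma f])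
  /\
  ~ @generates_SI K (Qn n) (@alphan n)
      (fun f => exists sigma : weight (Qn n),
         [/\ wdot (@alphan n) sigma = 0,
             wnorm (@alphan n) sigma < 2 ^+ n - 2
           & SIw sigma f]).
Proof.
pose V := @split_rep n K.
pose F := covering_det (@alphan n) (@depth n) (@tree_edge n) K.
have SIF : SI F by apply: SI_covering_det (@sink_hd n) (@source_tl n).
have FV : peval F V != 0.
  rewrite peval_covering_det -unitfE -unitmxE.
  exact: sym_covering_mx_split_unit.
pose d := (\sum_u alphan (@depth n u))%N.
have FsV c : peval F (fun a => c *: V a) = c ^+ d * peval F V.
  exact: peval_covering_detZ.
have d_gt0 : (0 < d)%N.
  have root_lt : (0 < (2 ^ n).-1)%N.
    by have := @ltn_expl 2 n isT; lia.
  by rewrite /d (bigD1 (Ordinal root_lt)) //= ltn_addr // alphan_root.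
(* Invariance under scaling would give [c ^+ d = 1] for all nonzero [c], hence [d = 0]. *)
have not_scale_inv :
    ~ (forall c, c != 0 -> peval F (fun a => c *: V a) = peval F V).
  move=> Fc; have := d_gt0.
  rewrite (infinite_nonzero_expr1 Kinf (n := d)) // => c c0.
  by apply: (mulIf FV); rewrite -FsV Fc // mul1r.
split=> [/(_ V)[null_V _]|gen].
  (* All small semi-invariants of nonzero weight vanish at [V], which would put [V] in the null cone
     and make [F] vanish there. *)
  move/eqP: FV; apply; apply: null_V => [f [sigma [sx s0 small fs]]|].
    apply/eqP; apply: contraT => fV; case: sx => x; case.
    exact: SIw_small_weight fs s0 small fV x.
  split=> //; split; first by exists d; apply: dhomog_covering_det.
  by move=> c Fc; apply: not_scale_inv => t _; rewrite Fc /peval !mevalC.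
(* Each generator [g_i] either vanishes at [V], hence at [cV], or has weight 0; so any polynomial in
   them takes equal values at [V] and [cV]. *)
have /gen [m [g [p [gS Fp]]]] := SIF.
apply: not_scale_inv => c c0; rewrite Fp /peval !comp_mpoly_meval.
apply: meval_eq => i; have [sigma [s0 small gs]] := gS i.
have [e [gE e1]] := SIw_scale V (@sink_hd n) (@source_tl n) gs c0.
rewrite -/(peval (tnth g i) V) -/(peval (tnth g i) (fun a => c *: V a)) gE.
have [->|gV] := eqVneq (peval (tnth g i) V) 0; first by rewrite mulr0.
by rewrite e1 ?mul1r //; apply: SIw_small_weight gs s0 small gV.
Qed.
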